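(* Let $\kappa$ be a $\lambda$-supercompact cardinal, let $\mathcal{U}$ be a normal fine ultrafilter on $\mathcal{P}_\kappa(\lambda)$, and assume $\lambda=\lambda^{<\lambda}$. Then the following are equivalent for every partial order $\mathbb{P}$: (1) $\mathbb{P}$ satisfies the $\kappa$-chain condition; (2) $\mathbb{P}$ is $\kappa$-Knaster; (3) $\mathbb{P}$ is $\kappa$-stationarily layered; (4) $\mathbb{P}$ is completely $\mathcal{U}$-layered.
   Context: A suborder $\mathbb{Q}\subseteq\mathbb{P}$ is a regular suborder if the inclusion map preserves incompatibility and every maximal antichain of $\mathbb{Q}$ is maximal in $\mathbb{P}$. $\mathrm{Reg}_\kappa(\mathbb{P})$ is the set of regular suborders of $\mathbb{P}$ of cardinality less than $\kappa$. $\mathbb{P}$ is $\kappa$-stationarily layered if $\mathrm{Reg}_\kappa(\mathbb{P})$ is stationary in $\mathcal{P}_\kappa(\mathbb{P})$ (Jech's stationarity: meets every $\subseteq$-cofinal subset closed under unions of increasing chains of length $<\kappa$). $\mathbb{P}$ is $\kappa$-Knaster if every $\kappa$-sized set of conditions has a $\kappa$-sized subset of pairwise compatible conditions. For a filter $\mathcal{F}$ on $\mathcal{P}_\kappa(\lambda)$: $\mathbb{P}$ is $\mathcal{F}$-layered if $|\mathbb{P}|\le\lambda$ and $\{a\in\mathcal{P}_\kappa(\lambda): s[a]\in\mathrm{Reg}_\kappa(\mathbb{P})\}\in\mathcal{F}$ for every surjection $s:\lambda\to\mathbb{P}$; $\mathbb{P}$ is completely $\mathcal{F}$-layered if every subset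 of $\mathbb{P}$ of size at most $\lambda$ is contained in a regular suborder of size at most $\lambda$ and every regular suborder of $\mathbb{P}$ of size at most $\lambda$ is $\mathcal{F}$-layered. *)

(* Defs.v *)
From mathcomp Require Import all_boot all_order all_classical.
From mathcomp Require wochoice.

Set Implicit Arguments.
Unset Strict Implicit.
Unset Printing Implicit Defensive.

Local Open Scope classical_set_scope.
Local Open Scope card_scope.
Local Open Scope order_scope.

Definition card_lt T U (A : set T) (B : set U) : Prop :=
  (A #<= B) /\ ~ (B #<= A).

Notation "A '#<' B" := (card_lt A B) (at level 70, no associativity) : card_scope.

(* A cardinal is an initial von Neumann ordinal, given up to isomorphism as a
   well-order each of whose proper initial segments has smaller cardinality. *)
Definition is_cardinal d (K : orderType d) : Prop :=
  wochoice.well_order (<=%O : rel K) /\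
  forall x : K, [set y : K | y < x] #< [set: K].

(* lambda^{<lambda} = lambda; a function from alpha to lambda is paired with
   its domain alpha, so the left-hand side is the union over alpha < lambda of
   the function spaces from alpha to lambda. *)
Definition weakpow_eq d (L : orderType d) : Prop :=
  [set: {alpha : L & [set beta : L | beta < alpha] -> L}] #= [set: L].

Definition Pkappa d (K : orderType d) T (X : set T) : set (set T) :=
  [set a | a `<=` X /\ a #< [set: K]].

Definition kappa_complete d (K : orderType d) I (F : set_system I) : Prop :=
  forall G : set (set I), G `<=` F -> G #< [set: K] -> F (\bigcap_(X in G) X).

Section FiltersOnPkappa.
Context dK dL (K : orderType dK) (L : orderType dL).
Implicit Type F : set_system (Pkappa K [set: L]).

Definition fine F : Prop := forall x : L, F [set a | val a x].

Definition normal F : Prop :=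
  forall f : Pkappa K [set: L] -> L,
    F [set a | val a (f a)] -> exists x : L, F [set a | f a = x].

Definition normal_fine_ultrafilter F : Prop :=
  [/\ UltraFilter F, kappa_complete K F, fine F & normal F].

End FiltersOnPkappa.

(* K is L-supercompact, through the standard first-order definition by a
   measure on P_K(L); the equivalent elementary embeddings of the universe are
   not objects of the theory. *)
Definition supercompact dK dL (K : orderType dK) (L : orderType dL) : Prop :=
  [/\ ~ countable [set: K], [set: K] #<= [set: L] &
      exists F : set_system (Pkappa K [set: L]), normal_fine_ultrafilter F].

(* A partial order is a subset P of a porderType, with the induced order, so
   that its suborders are partial orders in the same sense. *)
Section PartialOrders.
Context d (T : porderType d).
Implicit Types P Q A B : set T.

Definition compatible P (p q : T) : Prop :=
  exists2 r, P r & r <= p /\ r <= q.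

Definition antichain P A : Prop :=
  A `<=` P /\ forall p q, A p -> A q -> p <> q -> ~ compatible P p q.

Definition maximal_antichain P A : Prop :=
  antichain P A /\ forall B, antichain P B -> A `<=` B -> B = A.

Definition regular_suborder P Q : Prop :=
  [/\ Q `<=` P,
      forall p q, Q p -> Q q -> ~ compatible Q p q -> ~ compatible P p q &
      forall A, maximal_antichain Q A -> maximal_antichain P A].

Section Kappa.
Context dK (K : orderType dK).

Definition Reg P : set (set T) :=
  [set Q | regular_suborder P Q /\ Q #< [set: K]].

Definition chain_condition P : Prop :=
  forall A, antichain P A -> A #< [set: K].

Definition knaster P : Prop :=
  forall A, A `<=` P -> A #= [set: K] ->
    exists B, [/\ B `<=` A, B #= [set: K] &
                  forall p q, B p -> B q -> compatible P p q].

Definition cofinal_Pkappa P (C : set (set T)) : Prop :=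
  forall a, Pkappa K P a -> exists2 c, C c & a `<=` c.

(* Chains are indexed by the nonzero ordinals eta < kappa. *)
Definition chain_closed (C : set (set T)) : Prop :=
  forall (eta : K) (a : K -> set T),
    (exists xi, xi < eta) ->
    (forall xi, xi < eta -> C (a xi)) ->
    (forall xi zeta, xi <= zeta -> zeta < eta -> a xi `<=` a zeta) ->
    C (\bigcup_(xi in [set xi | xi < eta]) a xi).

Definition stationary P (S : set (set T)) : Prop :=
  forall C, C `<=` Pkappa K P -> cofinal_Pkappa P C -> chain_closed C ->
    S `&` C !=set0.

Definition stationarily_layered P : Prop := stationary P (Reg P).

Context dL (L : orderType dL) (F : set_system (Pkappa K [set: L])).

Definition layered P : Prop :=
  P #<= [set: L] /\
  forall s : L -> T, range s = P -> F [set a | Reg P (s @` val a)].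

Definition completely_layered P : Prop :=
  (forall A, A `<=` P -> A #<= [set: L] ->
     exists Q, [/\ A `<=` Q, regular_suborder P Q & Q #<= [set: L]]) /\
  (forall Q, regular_suborder P Q -> Q #<= [set: L] -> layered Q).

End Kappa.
End PartialOrders.

(* Main.v *)
(* A kappa-complete fine measure U makes kappa regular, and normality turns
   any choice of an element of a, made for U-almost all a, into a constant.

   Let Q be a kappa-c.c. order of size at most lambda and s : lambda -> Q onto.
   Pressing down, s[a] is closed under common lower bounds for almost all a.
   If maximal antichains A_a of s[a] are given, let A be the set of those p
   that lie in A_a for almost all a. It is an antichain, hence of size < kappa,
   so A is contained in A_a for almost all a; pressing down gives equality.
   Then A is maximal in Q, as every element of Q lies in almost all s[a].
   Hence s[a] is regular in Q for almost all a.

   Conversely, let A have size kappa and choose p_a in A \ s[a]. A reduct of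
   p_a in s[a] can be pressed down to a constant; then p_a and p_b are
   compatible as soon as p_a lies in s[b], and a maximal set of pairwise
   compatible p_a has size kappa.

   Regular suborders of size at most lambda exist since
   lambda^{<kappa} <= lambda, and one of them can moreover be closed under a
   monotone map from its finite subsets into a given club C. Almost all s[a]
   are closed under this map, so they are directed unions of members of C.

   Finally, if Q is a regular suborder of size < kappa such that each of its
   elements is compatible in Q with an element of A in Q, where A is a maximal
   antichain of P, then A is contained in Q, which bounds the size of A. *)
Require Import Defs.
From mathcomp Require Import all_boot all_order all_classical.
From mathcomp Require Import finmap.
From mathcomp Require wochoice.

Set Implicit Arguments.
Unset Strict Implicit.
Unset Printing Implicit Defensive.

Local Open Scope order_scope.
Local Open Scope classical_set_scope.
Local Open Scope card_scope.
Import Order.TTheory.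

(** * Cardinal comparison along a well-order *)

Section Cardinals.

Lemma card_le_surj T U (A : set T) (B : set U) (f : U -> T) :
  A `<=` f @` B -> A #<= B.
Proof. by move=> sAf; exact: card_le_trans (subset_card_le sAf) (card_image_le f B). Qed.

Lemma card_surj T U (A : set T) (B : set U) :
  A !=set0 -> A #<= B -> exists f : U -> T, A = f @` B.
Proof.
move=> /set0P A0 /pfcard_geP[A00|/surjfunPex//].
by move: A0; rewrite A00 eqxx.
Qed.

Lemma card_le_lt_trans T1 T2 T3 (A : set T1) (B : set T2) (C : set T3) :
  A #<= B -> B #< C -> A #< C.
Proof.
move=> AB [BC CB]; split; first exact: card_le_trans BC.
by move=> CA; apply: CB; exact: card_le_trans AB.
Qed.

Lemma card_lt_le_trans T1 T2 T3 (A : set T1) (B : set T2) (C : set T3) :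
  A #< B -> B #<= C -> A #< C.
Proof.
move=> [AB BA] BC; split; first exact: card_le_trans BC.
by move=> CA; apply: BA; exact: card_le_trans CA.
Qed.

Context d (K : orderType d).
Hypothesis K_wo : wochoice.well_order (<=%O : rel K).

Lemma wo_ind (P : K -> Prop) :
  (forall x, (forall y, y < x -> P y) -> P x) -> forall x, P x.
Proof.
move=> step x; apply: contrapT => Px.
have [|z [[/asboolP Pz zmin] _]] := K_wo (A := [pred x | `[< ~ P x >]]).
  by exists x; apply/asboolP.
apply: Pz; apply: step => y yz; apply: contrapT => Py.
by have := zmin y; rewrite inE leNgt yz asboolE => /(_ Py).
Qed.

(** Transfinite recursion along [K] picks elements of [X] distinct from all earlier ones. If it got
    stuck at [al], the values chosen below [al] would exhaust [X], against the hypothesis. *)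
Lemma card_segment T (X : set T) :
  (forall al : K, ~ (X #<= [set y : K | y < al])) -> [set: K] #<= X.
Proof.
move=> noseg.
have [[k0]|K0] := pselect (exists k : K, True); last first.
  by rewrite (_ : [set: K] = set0) // -subset0 => k _; apply: K0; exists k.
move=> _; have fresh (al : K) (g : forall be : K, be < al -> T) :
    {x | X x /\ forall be (h : be < al), g be h <> x}.
  apply: cid; apply: contrapT => nox.
  have [x0 Xx0] : X !=set0.
    by apply/set0P/negP => /eqP X0; apply: (noseg k0); rewrite X0.
  pose f be := if pselect (be < al) is left h then g be h else x0.
  apply: (noseg al); apply: (card_le_surj (f := f)) => x Xx.
  apply: contrapT => fx; apply: nox; exists x; split => // be h gx.
  apply: fx; exists be => //; rewrite /f; case: pselect => [h'|//].
  by rewrite (Prop_irrelevance h' h).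
have wf : well_founded (fun x y : K => x < y).
  by apply: wo_ind => x IH; constructor.
pose h := Fix wf (fun=> T) (fun al g => sval (fresh al g)).
have hE al : h al = sval (fresh al (fun be _ => h be)).
  rewrite /h Fix_eq // => x f g fg.
  by congr (sval (fresh x _)); do 2 apply: functional_extensionality_dep => ?.
have hX al : X (h al) by rewrite hE; case: (fresh _ _) => x [].
have hlt be al : be < al -> h be <> h al.
  by move=> ba; rewrite (hE al); case: (fresh _ _) => x [_ gx] /=; exact: gx.
have hinj : {in [set: K] &, injective h}.
  by move=> x y _ _ xy; case: (ltgtP x y) => // /hlt; rewrite xy.
rewrite -(card_le_eql (inj_card_eq hinj)).
by apply: subset_card_le => _ [al _ <-].
Qed.

Lemma card_lt_segment T (X : set T) :
  X #< [set: K] -> exists al : K, X #<= [set y : K | y < al].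
Proof.
move=> [_ KX]; apply: contrapT => noal; apply: KX; apply: card_segment => al Xal.
by apply: noal; exists al.
Qed.

Lemma card_ltNge T (X : set T) :
  (forall x : K, [set y : K | y < x] #< [set: K]) ->
  ~ (X #< [set: K]) -> [set: K] #<= X.
Proof.
move=> Kseg XK; apply: card_segment => al Xal; apply: XK.
exact: card_le_lt_trans (Kseg al).
Qed.

End Cardinals.

(** * Completeness, normality and pressing down for the measure *)

Section Measure.
Context dK dL (K : orderType dK) (L : orderType dL).
Hypotheses (K_card : is_cardinal K) (K_uncountable : ~ countable [set: K]).
Hypothesis KL : [set: K] #<= [set: L].
Variable U : set_system (Pkappa K [set: L]).
Hypothesis U_normal : normal_fine_ultrafilter U.

Let U_ultra : UltraFilter U. Proof. by case: U_normal. Qed.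
Local Existing Instance U_ultra.

Lemma measure_bigcap I (D : set I) (R : I -> set (Pkappa K [set: L])) :
  D #< [set: K] -> (forall i, D i -> U (R i)) ->
  U [set a | forall i, D i -> R i a].
Proof.
have [_ complete _ _] := U_normal.
move=> DK UR; have URD : U (\bigcap_(X in R @` D) X).
  apply: complete; last exact: card_le_lt_trans (card_image_le _ _) DK.
  by move=> _ [i Di <-]; exact: UR.
by apply: filterS URD => a Ra i Di; apply: (Ra (R i)); exists i.
Qed.

Lemma measure_fine_small T (s : L -> T) (X : set T) :
  X #< [set: K] -> X `<=` range s -> U [set a | X `<=` s @` val a].
Proof.
have [_ _ fineU _] := U_normal.
move=> XK Xs; apply: measure_bigcap => // x /Xs[l _ <-].
by apply: filterS (fineU l) => a al; exists l.
Qed.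

(** Otherwise almost every [a] contains some [x] with [a] outside [R x]. By normality a choice of
    such indices is constant on a set in [U], against the hypothesis on that [R x]. *)
Lemma measure_diagonal (R : L -> set (Pkappa K [set: L])) :
  (forall x, U (R x)) -> U [set a | forall x, val a x -> R x a].
Proof.
have [_ _ _ normalU] := U_normal.
move=> UR; have [//|UC] := in_ultra_setVsetC [set a | forall x, val a x -> R x a] U_ultra.
(* [x0] is only a default index where [a] has no bad one. *)
have [a0 /= /existsNP[x0 _]] := filter_ex UC.
have ex a : exists x, ~ (forall x, val a x -> R x a) -> val a x /\ ~ R x a.
  have [Ra|/existsNP[x /not_implyP Rx]] := pselect (forall x, val a x -> R x a).
    by exists x0.
  by exists x.
have [f fP] := choice ex.
have [|x Ufx] := normalU f; first by apply: filterS UC => a /fP[].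
have [a [/= /fP[_ nR] [fa Rx]]] := filter_ex (filterI UC (filterI Ufx (UR x))).
by case: nR; rewrite fa.
Qed.

(** If no [R x] is in [U], all complements are, and their diagonal intersection is disjoint from the
    given set. *)
Lemma measure_pressing_down (R : L -> set (Pkappa K [set: L])) :
  U [set a | exists2 x, val a x & R x a] -> exists x, U (R x).
Proof.
move=> UR; apply: contrapT => noR.
have UC x : U (~` R x).
  by have [URx|//] := in_ultra_setVsetC (R x) U_ultra; case: noR; exists x.
have [a [[x ax Rx] /(_ _ ax)]] := filter_ex (filterI UR (measure_diagonal UC)).
exact.
Qed.

(** Regularity of kappa. Otherwise the copy [range i] of kappa in lambda is covered by fewer than
    kappa small pieces; by fineness and completeness almost every [a] contains them all, yet [a] has
    size below kappa. *)
Lemma small_bigcup I T (D : set I) (X : I -> set T) :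
  D #< [set: K] -> (forall i, D i -> X i #< [set: K]) ->
  \bigcup_(i in D) X i #< [set: K].
Proof.
move=> DK XK; apply: contrapT => /(card_ltNge K_card.1 K_card.2) KY.
have K0 : [set: K] !=set0.
  by apply/set0P/negP => /eqP K0; apply: K_uncountable; rewrite K0.
have [g gE] := card_surj K0 KY.
have [j jE] : exists j : L -> K, [set: K] = range j by exact: card_surj.
have jK k : exists l, j l = k.
  by have : [set: K] k by []; rewrite jE => -[l _ <-]; exists l.
have [i iK] := choice jK.
have : U [set a | forall n, D n -> (i \o g) @` X n `<=` val a].
  apply: measure_bigcap => // n Dn.
  have [Z1 Z2] : (i \o g) @` X n #< [set: K] /\ (i \o g) @` X n `<=` range id.
    split; last by move=> l _; exists l.
    exact: card_le_lt_trans (card_image_le _ _) (XK n Dn).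
  by apply: filterS (measure_fine_small Z1 Z2) => a /=; rewrite image_id.
case/filter_ex => a aX; have [_ [_]] := set_valP a; apply.
apply: (card_le_surj (f := j)) => k _; exists (i k) => //.
have : [set: K] k by []; rewrite gE => -[y [n Dn Xy] gy].
by apply: (aX n Dn); exists y => //=; rewrite gy.
Qed.

Lemma countable_small T (X : set T) : countable X -> X #< [set: K].
Proof.
move=> Xc; split; last by move=> KX; apply: K_uncountable; exact: card_le_trans Xc.
apply: card_le_trans Xc _; apply/infiniteP => /finite_set_countable.
exact: K_uncountable.
Qed.

Lemma small_setU T (X Y : set T) :
  X #< [set: K] -> Y #< [set: K] -> X `|` Y #< [set: K].
Proof.
move=> XK YK; rewrite -bigcup2E; apply: small_bigcup.
  exact: countable_small.
by case=> [|[|n]] _ //=; apply: countable_small.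
Qed.

(** For a fixed length, one diagonal intersection per entry suffices; countable completeness then
    joins all lengths. *)
Lemma measure_diagonal_seq (R : seq L -> set (Pkappa K [set: L])) :
  (forall l, U (R l)) ->
  U [set a | forall l, (forall x, x \in l -> val a x) -> R l a].
Proof.
move=> UR; have step n (R' : seq L -> set (Pkappa K [set: L])) :
    (forall l, U (R' l)) ->
    U [set a | forall l, size l = n -> (forall x, x \in l -> val a x) -> R' l a].
  elim: n R' => [|n IH] R' UR'.
    by apply: filterS (UR' [::]) => a Ra [|].
  have UR1 x := IH (fun l => R' (x :: l)) (fun l => UR' (x :: l)).
  apply: filterS (measure_diagonal UR1) => a aR [//|x l] [sl] al.
  apply: (aR x) => //; first by apply: al; rewrite inE eqxx.
  by move=> y yl; apply: al; rewrite inE yl orbT.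
have : U [set a | forall n, [set: nat] n -> forall l, size l = n ->
    (forall x, x \in l -> val a x) -> R l a].
  apply: measure_bigcap; first exact: countable_small.
  by move=> n _; exact: step.
by apply: filterS => a aR l; exact: (aR (size l)).
Qed.

End Measure.

(** * Maximal antichains, regular suborders and reducts *)

Section RegularSuborders.
Context d (T : porderType d).
Implicit Types P Q A B D : set T.

Lemma compatibleC P p q : compatible P p q -> compatible P q p.
Proof. by case=> r Pr [rp rq]; exists r. Qed.

Lemma compatible_refl P p : P p -> compatible P p p.
Proof. by exists p. Qed.

Lemma compatible_sub P Q p q : Q `<=` P -> compatible Q p q -> compatible P p q.
Proof. by move=> QP [r /QP Pr rpq]; exists r. Qed.

Lemma compatible_le P p q r : r <= p -> compatible P r q -> compatible P p q.
Proof. by move=> rp [t Pt [tr tq]]; exists t => //; split => //; exact: le_trans rp. Qed.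

Lemma antichain_lift P Q A : Q `<=` P ->
  (forall p q, Q p -> Q q -> compatible P p q -> compatible Q p q) ->
  antichain Q A -> antichain P A.
Proof.
move=> QP PQ [AQ Aanti]; split; first exact: subset_trans QP.
by move=> p q Ap Aq pq /PQ; apply: contra_not (Aanti p q Ap Aq pq); apply; exact: AQ.
Qed.

(** An element compatible with nothing in [A] could be adjoined to it, so maximality is
    predensity. *)
Lemma maximal_antichainE P A : antichain P A ->
  maximal_antichain P A <-> forall p, P p -> exists2 q, A q & compatible P p q.
Proof.
move=> antiA; split=> [[_ Amax] p Pp|pre].
  apply: contrapT => nocomp.
  have : A `|` [set p] = A.
    apply: Amax; last by move=> q; left.
    split=> [q [/antiA.1//|->//]|q r [Aq|->] [Ar|->]] // qr.
    - exact: antiA.2.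
    - by move=> /compatibleC qp; apply: nocomp; exists q.
    - by move=> rp; apply: nocomp; exists r.
  move=> /seteqP[/(_ p) Ap _]; apply: nocomp; exists p; last exact: compatible_refl.
  by apply: Ap; right.
split=> // B [BP Banti] AB; apply/seteqP; split => // b Bb.
have [q Aq bq] := pre b (BP b Bb).
by have [->//|/(Banti _ _ Bb (AB _ Aq))] := pselect (b = q).
Qed.

Lemma exists_maximal_antichain P A D : D `<=` P -> antichain P A -> A `<=` D ->
  exists B, [/\ antichain P B, A `<=` B, B `<=` D &
    forall p, D p -> exists2 q, B q & compatible P p q].
Proof.
move=> DP antiA AD.
(* Zorn is applied to the part added to [A], so that the empty union of the empty chain also
   qualifies. *)
have [|B [[antiB BD] Bmax]] :=
    @Zorn_bigcup _ [set X | antichain P (A `|` X) /\ X `<=` D].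
  move=> F FP Ftot; split; last by move=> p [X /FP[_ XD] /XD].
  split=> [p [/antiA.1//|[X /FP[[AX _] _] Xp]]|p q]; first by apply: AX; right.
  move=> [Ap|[X FX Xp]] [Aq|[Y FY Yq]].
  - exact: antiA.2.
  - by apply: (FP Y FY).1.2; [left|right].
  - by apply: (FP X FX).1.2; [right|left].
  - have [XY|YX] := Ftot X Y FX FY.
      by apply: (FP Y FY).1.2; right => //; exact: XY.
    by apply: (FP X FX).1.2; right => //; exact: YX.
exists (A `|` B); split=> //; first by move=> p [/AD|/BD].
move=> p Dp; have Pp := DP p Dp; apply: contrapT => nocomp.
have nB : ~ B p.
  by move=> Bp; apply: nocomp; exists p; [right|exact: compatible_refl].
apply: (Bmax (B `|` [set p])).
  split; first by move=> q; left.
  by move=> /(_ p) pB; apply: nB; apply: pB; right.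
split; last by move=> q [/BD//|->].
rewrite setUA; split=> [q [/antiB.1//|->]|q r [Aq|->] [Ar|->]] // qr.
- exact: antiB.2.
- by move=> /compatibleC qp; apply: nocomp; exists q.
- by move=> rp; apply: nocomp; exists r.
Qed.

Lemma regular_compatible P Q p q :
  regular_suborder P Q -> Q p -> Q q -> compatible P p q -> compatible Q p q.
Proof. by move=> [_ PQ _] Qp Qq pq; apply: contrapT => /(PQ p q Qp Qq). Qed.

Lemma regular_suborderI P Q : Q `<=` P ->
  (forall p q, Q p -> Q q -> compatible P p q -> compatible Q p q) ->
  (forall A, maximal_antichain Q A -> forall p, P p ->
    exists2 q, A q & compatible P p q) ->
  regular_suborder P Q.
Proof.
move=> QP PQ max; split=> // [p q Qp Qq|A Amax].
  by apply: contra_not; exact: PQ.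
by apply/maximal_antichainE; [exact: antichain_lift Amax.1|exact: max].
Qed.

Lemma regular_suborder_trans P Q R :
  regular_suborder P Q -> regular_suborder Q R -> regular_suborder P R.
Proof.
move=> [QP PQ Qmax] [RQ QR Rmax]; split; first exact: subset_trans QP.
  by move=> p q Rp Rq /(QR p q Rp Rq)/(PQ p q (RQ p Rp) (RQ q Rq)).
by move=> A /Rmax/Qmax.
Qed.

(** Without a reduct, the elements of [Q] incompatible with [p] are dense in [Q]. A maximal
    antichain of such elements is maximal in [Q], hence in [P], but misses [p]. *)
Lemma regular_reduct P Q p : regular_suborder P Q -> P p ->
  exists2 q, Q q & forall r, Q r -> r <= q -> compatible P r p.
Proof.
move=> regQ Pp; apply: contrapT => nored.
pose D := [set r | Q r /\ ~ compatible P r p].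
have dense q : Q q -> exists2 r, D r & r <= q.
  move=> Qq; apply: contrapT => nor; apply: nored; exists q => // r Qr rq.
  by apply: contrapT => rp; apply: nor; exists r.
have [|||A [antiA _ AD Amax]] := @exists_maximal_antichain Q set0 D.
- by move=> r [].
- by split=> //.
- by [].
have maxA : maximal_antichain Q A.
  apply/maximal_antichainE => // q /dense[r Dr rq].
  by have [a Aa ra] := Amax r Dr; exists a => //; exact: compatible_le ra.
have [_ _ /(_ A maxA) maxPA] := regQ.
have [a /AD[_ ap] pa] := (maximal_antichainE maxPA.1).1 maxPA p Pp.
by apply: ap; exact: compatibleC.
Qed.

End RegularSuborders.

(** * Layering, the Knaster property and the chain condition *)

Section Layers.
Context dK dL (K : orderType dK) (L : orderType dL).
Hypotheses (K_card : is_cardinal K) (K_uncountable : ~ countable [set: K]).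
Hypothesis KL : [set: K] #<= [set: L].
Variable U : set_system (Pkappa K [set: L]).
Hypothesis U_normal : normal_fine_ultrafilter U.
Context d (T : porderType d).
Implicit Types P Q A : set T.

Let U_ultra : UltraFilter U. Proof. by case: U_normal. Qed.
Local Existing Instance U_ultra.
Let K0 : [set: K] !=set0.
Proof. by apply/set0P/negP => /eqP K0; apply: K_uncountable; rewrite K0. Qed.

Lemma exists_subset_card A : ~ A #< [set: K] ->
  exists2 A', A' `<=` A & A' #= [set: K].
Proof.
move=> /(card_ltNge K_card.1 K_card.2) KA.
have [g gE] := card_surj K0 KA.
have ex k : exists p, A p /\ g p = k.
  by have : [set: K] k by []; rewrite gE => -[p Ap <-]; exists p.
have [f fP] := choice ex.
exists (range f); first by move=> _ [k _ <-]; exact: (fP k).1.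
by apply: inj_card_eq => k l _ _ kl; rewrite -(fP k).2 kl (fP l).2.
Qed.

Lemma knaster_chain_condition P : knaster K P -> chain_condition K P.
Proof.
move=> knP A antiA; apply: contrapT => /exists_subset_card[A' A'A A'K].
have [|B [BA' BK Bcomp]] := knP A' _ A'K; first exact: subset_trans antiA.1.
have Buniq p q : B p -> B q -> p = q.
  move=> Bp Bq; apply: contrapT => pq.
  by apply: (antiA.2 p q _ _ pq (Bcomp p q Bp Bq)); apply/A'A/BA'.
have Bfin : countable B.
  apply: finite_set_countable; have [[b Bb]|B0] := pselect (B !=set0).
    by apply: sub_finite_set (finite_set1 b) => p Bp; exact: Buniq.
  rewrite (_ : B = set0); first exact: finite_set0.
  by rewrite -subset0 => p Bp; apply: B0; exists p.
by apply: K_uncountable; rewrite -(eq_countable BK).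
Qed.

Lemma stationarily_layered_chain_condition P :
  stationarily_layered K P -> chain_condition K P.
Proof.
move=> stP A0 antiA0.
have [|//||A [antiA A0A _ Amax]] := @exists_maximal_antichain _ _ P A0 P.
- by [].
- exact: antiA0.1.
(* Compatibility is required inside [a], so that for a member [Q] of [C] the part of [A] in [Q] is
   predense in [Q] itself. *)
pose C := [set a : set T | Pkappa K P a /\ forall p, a p -> exists2 q, A q /\ a q &
   compatible a p q].
have [] := stP C.
- by move=> a [].
- have ex p : exists qr : T * T, P p -> [/\ A qr.1, P qr.2 & qr.2 <= p /\ qr.2 <= qr.1].
    have [Pp|nPp] := pselect (P p); last by exists (p, p).
    by have [q Aq [r Pr rpq]] := Amax p Pp; exists (q, r).
  have [f fP] := choice ex.
  move=> a [aP aK].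
  (* Each element gets its two witnesses, a member of [A] and a common lower bound, one round later,
     so countably many rounds close [a] off. *)
  pose b n := iter n (fun b => b `|` ((fst \o f) @` b `|` (snd \o f) @` b)) a.
  have bP n : Pkappa K P (b n).
    elim: n => [//|n [bP bK]]; split=> [p|].
      case=> [/bP//|[[q /bP/fP[Aq _ _] <-]|[q /bP/fP[_ Pq _] <-]]//].
      exact: antiA.1.
    do 2! [apply: (small_setU K_card K_uncountable KL U_normal) => //];
      exact: card_le_lt_trans (card_image_le _ _) bK.
  exists (\bigcup_n b n); last by move=> p ap; exists 0%N.
  split.
    split; first by apply: bigcup_sub => n _; exact: (bP n).1.
    apply: (small_bigcup K_card K_uncountable KL U_normal).
      exact: (countable_small K_uncountable).
    by move=> n _; exact: (bP n).2.
  move=> p [n _ bp]; have /fP[Aq Pr rpq] := (bP n).1 p bp.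
  exists (f p).1; first by split=> //; exists n.+1 => //; right; left; exists p.
  by exists (f p).2 => //; exists n.+1 => //; right; right; exists p.
- move=> eta a [xi0 _] aC amono; split.
    split; first by apply: bigcup_sub => xi /aC[[]].
    apply: (small_bigcup K_card K_uncountable KL U_normal); first exact: K_card.2.
    by move=> xi /aC[[]].
  move=> p [xi xieta ap]; have [_ /(_ p ap)[q [Aq aq] pq]] := aC xi xieta.
  exists q; first by split=> //; exists xi.
  by apply: compatible_sub pq; exact: bigcup_sup.
move=> Q [[regQ QK] [_ QC]].
have [QP _ Qmax] := regQ.
have AQ : maximal_antichain Q (A `&` Q).
  apply/maximal_antichainE => [|p /QC[q [Aq Qq] pq]]; last by exists q.
  split=> [p [//]|p q [Ap _] [Aq _] pq].
  by apply: contra_not (antiA.2 p q Ap Aq pq); exact: compatible_sub.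
have AE : A = A `&` Q by apply: (Qmax _ AQ).2 => // p [].
apply: card_le_lt_trans QK; apply: subset_card_le => p /A0A.
by rewrite AE => -[].
Qed.

Lemma completely_layered_knaster P : completely_layered U P -> knaster K P.
Proof.
move=> [cover layers] A AP AK.
have AL : A #<= [set: L] by rewrite (card_le_eql AK).
have [Q [AQ regQ QL]] := cover A AP AL.
have [_ QU] := layers Q regQ QL.
have A0 : A !=set0.
  apply/set0P/negP => /eqP A0; apply: K_uncountable.
  by rewrite -(eq_countable AK) A0.
have [s sE] : exists s : L -> T, Q = range s.
  by apply: card_surj => //; case: A0 => p /AQ Qp; exists p.
have [QP _ _] := regQ.
have ex (a : Pkappa K [set: L]) : exists p : T,
    Reg K Q (s @` val a) -> A p /\ ~ (s @` val a) p.
  have [[_ sK]|nR] := pselect (Reg K Q (s @` val a)); last first.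
    by have [p _] := A0; exists p.
  apply: contrapT => nop; have [_] := sK; apply.
  rewrite -(card_le_eql AK); apply: subset_card_le => p Ap.
  by apply: contrapT => ap; apply: nop; exists p.
have [p pP] := choice ex.
(* Here [s x] is a reduct of [p a] to the layer; pressing down makes it the same for almost all
   [a]. *)
pose R x := [set a | Reg K Q (s @` val a) /\ (s @` val a) (s x) /\
  forall r, (s @` val a) r -> r <= s x -> compatible Q r (p a)].
have [x UR] : exists x, U (R x).
  apply: (measure_pressing_down U_normal); apply: filterS (QU s (esym sE)) => a aR.
  have [q [x ax <-] red] := regular_reduct aR.1 (AQ _ (pP a aR).1).
  by exists x => //; split=> //; split=> //; exists x.
(* The reduct [s x] is compatible with [p a], so by regularity they have a common lower bound in the
   layer of [b]. It lies below [s x], which is also the reduct of [p b]. *)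
have linked (a b : Pkappa K [set: L]) :
    R x a -> R x b -> (s @` val b) (p a) -> compatible Q (p a) (p b).
  move=> [aR [ax ared]] [[bR _] [bx bred]] bp.
  have [r br [rx rp]] : compatible (s @` val b) (s x) (p a).
    by apply: regular_compatible bR _ _ (ared _ _ _).
  by apply: compatible_le rp _; exact: bred.
pose lin B := forall q r, B q -> B r -> compatible Q q r.
have [|B [[BR Blin] Bmax]] := @Zorn_bigcup _ [set B | B `<=` p @` R x /\ lin B].
  move=> F FP Ftot; split; first by move=> q [X /FP[+ _]]; apply.
  move=> q r [X FX Xq] [Y FY Yr]; have [XY|YX] := Ftot X Y FX FY.
    by apply: (FP Y FY).2 => //; exact: XY.
  by apply: (FP X FX).2 => //; exact: YX.
have BA : B `<=` A by move=> q /BR[a [aR _] <-]; exact: (pP a aR).1.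
exists B; split=> //; last first.
  by move=> q r Bq Br; exact: compatible_sub QP (Blin q r Bq Br).
rewrite card_eq_le; apply/andP; split.
  by rewrite -(card_le_eqr AK); exact: subset_card_le.
(* If [B] were small, some layer given by a [b] in [R x] would contain it; then [p b], outside that
   layer, is compatible with all of [B] and contradicts its maximality. *)
apply: (card_ltNge K_card.1 K_card.2) => BK.
have Bs : B `<=` range s by rewrite -sE; exact: subset_trans AQ.
have [b [bR Bb]] := filter_ex (filterI UR (measure_fine_small U_normal BK Bs)).
have [Apb nbp] := pP b bR.1.
apply: (Bmax (B `|` [set p b])).
  split; first by move=> q; left.
  by move=> /(_ (p b)) pB; apply/nbp/Bb/pB; right.
split=> [q [/BR//|->]|q r]; first by exists b.
have pB q' : B q' -> compatible Q q' (p b).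
  move=> Bq; have [a aR qE] := BR _ Bq; rewrite -qE; apply: linked => //.
  by rewrite qE; exact: Bb.
case=> [Bq|->] [Br|->].
- exact: Blin.
- exact: pB.
- by apply/compatibleC/pB.
- by apply: compatible_refl; exact: AQ.
Qed.

Lemma chain_condition_regular P Q :
  chain_condition K P -> regular_suborder P Q -> chain_condition K Q.
Proof.
move=> ccP regQ A antiA; have [QP _ _] := regQ; apply: ccP.
apply: antichain_lift QP _ antiA => p q; exact: regular_compatible.
Qed.

Lemma chain_condition_layered Q :
  chain_condition K Q -> Q #<= [set: L] -> layered U Q.
Proof.
move=> ccQ QL; split=> // s sE.
have [_ _ fineU _] := U_normal.
have sQ x : Q (s x) by rewrite -sE; exists x.
have s_sub (a : Pkappa K [set: L]) : s @` val a `<=` Q by move=> _ [x _ <-].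
pose good (a : Pkappa K [set: L]) := forall p q, (s @` val a) p -> (s @` val a) q ->
  compatible Q p q -> compatible (s @` val a) p q.
have Ugood : U good.
  (* For fixed [x] and [y] a single lower bound [s z] serves, and [z] is in almost every [a]; two
     diagonal intersections then treat all pairs at once. *)
  have Ucomp x y : U [set a | compatible Q (s x) (s y) ->
      compatible (s @` val a) (s x) (s y)].
    have [[r]|nc] := pselect (compatible Q (s x) (s y)); last by apply: filterE => a /nc.
    rewrite -sE => -[z _ <-] zxy; apply: filterS (fineU z) => a az _.
    by exists (s z) => //; exists z.
  have := measure_diagonal U_normal (fun x => measure_diagonal U_normal (Ucomp x)).
  by apply: filterS => a aG _ _ [x ax <-] [y ay <-]; exact: aG.
have lift a A : good a -> antichain (s @` val a) A -> antichain Q A.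
  by move=> ga; exact: antichain_lift.
pose full (a : Pkappa K [set: L]) := forall A, maximal_antichain (s @` val a) A ->
  forall p, Q p -> exists2 q, A q & compatible Q p q.
suff Ufull : U full.
  apply: filterS (filterI Ugood Ufull) => a [ga fa]; split.
    exact: regular_suborderI.
  have [_ aK] := set_valP a.
  exact: card_le_lt_trans (card_image_le _ _) aK.
have [//|UN] := in_ultra_setVsetC full U_ultra.
have exA (a : Pkappa K [set: L]) : exists A, ~ full a ->
    maximal_antichain (s @` val a) A /\
    ~ forall p, Q p -> exists2 q, A q & compatible Q p q.
  have [fa|/existsNP[A /not_implyP Amax]] := pselect (full a); last by exists A.
  by exists set0 => /(_ fa).
have [A AP] := choice exA.
pose A0 := [set p | U [set a | A a p]].
have UNg : U (~` full `&` good) by exact: filterI.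
have antiA0 : antichain Q A0.
  split=> [p Up|p q Up Uq pq].
    have [a [[Na ga] Ap]] := filter_ex (filterI UNg Up).
    by have [[[Aa _] _] _] := AP a Na; exact/s_sub/Aa.
  have [a [[Na ga] [Ap Aq]]] := filter_ex (filterI UNg (filterI Up Uq)).
  have [[antiA _] _] := AP a Na.
  exact: (lift a _ ga antiA).2.
have UA0A : U [set a | forall p, A0 p -> A a p].
  by apply: (measure_bigcap U_normal) => //; exact: ccQ.
(* [U] decides for each [x] whether [s x] belongs to [A a]; the diagonal intersection collects these
   decisions for all [x] in [a]. *)
have UAA0 : U [set a | forall x, val a x -> A a (s x) -> A0 (s x)].
  apply: (measure_diagonal U_normal) => x.
  have [Ux|Ux] := in_ultra_setVsetC [set a | A a (s x)] U_ultra.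
    exact: filterE.
  by apply: filterS Ux => a /= nA /nA.
have A0max p : Q p -> exists2 q, A0 q & compatible Q p q.
  rewrite -{1}sE => -[x _ <-].
  have [a [[Na ga] [ax aA]]] := filter_ex (filterI UNg (filterI (fineU x) UAA0)).
  have [maxA _] := AP a Na.
  have [|q Aq xq] := (maximal_antichainE maxA.1).1 maxA (s x); first by exists x.
  exists q; last exact: compatible_sub xq.
  have [y ay yq] := maxA.1.1 q Aq.
  by rewrite -yq; apply: aA => //; rewrite yq.
(* Some [A a] that is not predense in [Q] contains the predense set [A0]. *)
have [a [[Na _] aA]] := filter_ex (filterI UNg UA0A).
have [_ []] := AP a Na; move=> p /A0max[q A0q pq].
by exists q => //; exact: aA.
Qed.

End Layers.

(** * Cardinal arithmetic at lambda and small-set closures *)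

Section Closure.
Context dK dL (K : orderType dK) (L : orderType dL).
Hypotheses (K_card : is_cardinal K) (K_uncountable : ~ countable [set: K]).
Hypotheses (L_card : is_cardinal L) (KL : [set: K] #<= [set: L]).
Hypothesis L_pow : weakpow_eq L.
Variable U : set_system (Pkappa K [set: L]).
Hypothesis U_normal : normal_fine_ultrafilter U.

Let Lseq := {alpha : L & [set beta : L | beta < alpha] -> L}.

Let L0 : [set: L] !=set0.
Proof.
apply/set0P/negP => /eqP L0; apply: K_uncountable; apply: card_le_trans KL _.
by rewrite L0; exact: card_ge0.
Qed.

Lemma card_Lseq_surj T (X : set T) (f : Lseq -> T) :
  X `<=` range f -> X #<= [set: L].
Proof.
move=> Xf; rewrite -(card_le_eqr L_pow); exact: card_le_surj Xf.
Qed.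

(** A pair is coded as a function on an initial segment [al] that surjects onto the booleans, hence
    as an element of lambda^{<lambda}. *)
Lemma card_prod : [set: L * L] #<= [set: L].
Proof.
have [bK _] : [set: bool] #< [set: K] by exact: countable_small.
have bL : [set: bool] #< [set: L].
  by apply: card_lt_le_trans KL; exact: countable_small.
have [al bal] := card_lt_segment L_card.1 bL.
have [|h hE] := card_surj _ bal; first by exists true.
have exb b : exists be, be < al /\ h be = b.
  by have : [set: bool] b by []; rewrite hE => -[be ? <-]; exists be.
have [i iP] := choice exb.
(* The value off the domain of [c] is arbitrary. *)
pose ext (c : Lseq) l : L :=
  if pselect (l < projT1 c) is left lt then 
    projT2 c (SigSub (mem_set (lt : [set be | be < projT1 c] l))) else l.
apply: (card_Lseq_surj (f := fun c => (ext c (i true), ext c (i false)))).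
move=> [x y] _; exists (existT _ al (fun b => if h (val b) then x else y)) => //.
have [it ht] := iP true; have [jf hf] := iP false.
rewrite /ext /=; case: pselect => // ?; case: pselect => // ? /=.
by rewrite ht hf.
Qed.

Lemma card_bigcup I T (D : set I) (X : I -> set T) :
  D #<= [set: L] -> (forall i, D i -> X i #<= [set: L]) ->
  \bigcup_(i in D) X i #<= [set: L].
Proof.
move=> DL XL.
have [[t0 [i0 Di0 _]]|] := pselect ((\bigcup_(i in D) X i) !=set0); last first.
  by move=> /nonemptyPn ->; exact: card_ge0.
have [|g gE] := card_surj _ DL; first by exists i0.
have exh i : exists h : L -> T, D i -> X i `<=` range h.
  have [Di|] := pselect (D i); last by exists (fun=> t0).
  have [Xi|] := pselect (X i !=set0); last first.
    by move=> Xi0; exists (fun=> t0) => _ t Xit; case: Xi0; exists t.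
  by have [h ->] := card_surj Xi (XL i Di); exists h => _.
have [h hP] := choice exh.
apply: card_le_trans card_prod.
apply: (card_le_surj (f := fun l => h (g l.1) l.2)) => t [i Di Xit].
have [l2 _ <-] := hP i Di t Xit.
by move: Di; rewrite gE => -[l1 _ <-]; exists (l1, l2).
Qed.

Lemma card_setU T (X Y : set T) :
  X #<= [set: L] -> Y #<= [set: L] -> X `|` Y #<= [set: L].
Proof.
move=> XL YL; rewrite -bigcup2E; apply: card_bigcup.
  apply: card_le_trans KL.
  by have [] := countable_small K_uncountable (countableP [set: nat]).
by case=> [|[|n]] _ //=; exact: card_ge0.
Qed.

(** This is lambda^{<kappa} <= lambda: a nonempty small subset is enumerated along an initial
    segment of lambda, which gives a member of lambda^{<lambda}. *)
Lemma card_small_subsets T (Y : set T) : Y #<= [set: L] ->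
  [set X : set T | X `<=` Y /\ X #< [set: K]] #<= [set: L].
Proof.
move=> YL; have [Y0|] := pselect (Y !=set0); last first.
  move=> /nonemptyPn ->; apply: card_le_trans KL.
  have : [set X : set T | X `<=` set0 /\ X #< [set: K]] `<=` [set set0].
    by move=> X [X0 _]; apply/seteqP; split.
  move=> /subset_card_le/card_le_trans; apply.
  by have [] := countable_small K_uncountable (finite_set_countable (finite_set1 (@set0 T))).
have [t tE] := card_surj Y0 YL.
have exz x : exists l, Y x -> t l = x.
  have [|nYx] := pselect (Y x); last by have [l _] := L0; exists l.
  by rewrite tE => -[l _ tl]; exists l.
have [z zP] := choice exz.
(* The least element [m] has an empty initial segment, so a sequence with domain [m] codes the empty
   subset. *)
have [m mmin] : exists m : L, forall y, ~ y < m.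
  apply: contrapT => nom; have [l _] := L0.
  apply: (wo_ind L_card.1 (P := fun=> False)) l => x IH.
  by apply: nom; exists x => y /IH.
apply: (card_Lseq_surj (f := fun c => t @` range (projT2 c))) => X [XY XK].
have [X0|] := pselect (X !=set0); last first.
  move=> /nonemptyPn ->; exists (existT _ m (fun=> m)) => //=.
  by rewrite -subset0 => x [l [b _ bl] lx]; case: (mmin (val b)); exact: set_valP b.
have [al Xal] := card_lt_segment L_card.1 (card_lt_le_trans XK KL).
have [h hE] := card_surj X0 Xal.
exists (existT _ al (fun b => z (h (val b)))) => //=.
have hX be : be < al -> Y (h be) by move=> ba; apply: XY; rewrite hE; exists be.
apply/seteqP; split=> [_ [_ [b _ <-] <-]|].
  have bal := set_valP b; rewrite zP; last exact: hX.
  by rewrite hE; exists (val b).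
rewrite {1}hE => _ [be ba <-]; exists (z (h be)); last by rewrite zP //; exact: hX.
by exists (SigSub (mem_set (ba : [set be | be < al] be))).
Qed.

(** Were [f] unbounded on [X], the closed initial segments up to its values would cover kappa by few
    small sets. *)
Lemma small_bounded T (X : set T) (f : T -> K) :
  X #< [set: K] -> exists zeta, forall x, X x -> f x < zeta.
Proof.
move=> XK; apply: contrapT => nob.
have : \bigcup_(x in X) ([set y | y < f x] `|` [set f x]) #< [set: K].
  apply: (small_bigcup K_card K_uncountable KL U_normal) => // x _.
  apply: (small_setU K_card K_uncountable KL U_normal); first exact: K_card.2.
  by apply: countable_small => //; apply: finite_set_countable; exact: finite_set1.
case=> _; apply; apply: subset_card_le => k _; apply: contrapT => nk.
apply: nob; exists k => x Xx; rewrite ltNge; apply/negP; rewrite le_eqVlt => kf.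
by apply: nk; exists x => //; case/orP: kf => [/eqP|] ?; [right|left].
Qed.

Section Stages.
Variables (T : Type) (A : set T) (H : set T -> set T).

(** A hierarchy closing [A] under [H]; [f] assigns to each element of [X] an earlier stage where it
    has appeared. *)
Inductive stage (xi : K) (t : T) : Prop :=
| stage_base of A t
| stage_step X (f : T -> K) of X #< [set: K] & (forall x, X x -> f x < xi) &
    (forall x, X x -> stage (f x) x) & H X t.

Hypotheses (AL : A #<= [set: L]).
Hypothesis (HL : forall X, X #< [set: K] -> H X #<= [set: L]).

Lemma card_stage xi : stage xi #<= [set: L].
Proof.
elim/(wo_ind K_card.1): xi => xi IH.
pose Y := \bigcup_(eta in [set eta | eta < xi]) stage eta.
have YL : Y #<= [set: L].
  by apply: card_bigcup => //; exact: card_le_trans (card_leT _) KL.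
have : A `|` \bigcup_(X in [set X | X `<=` Y /\ X #< [set: K]]) H X #<= [set: L].
  apply: card_setU => //; apply: card_bigcup; first exact: card_small_subsets.
  by move=> X [_ /HL].
apply: card_le_trans; apply: subset_card_le => t [At|X f XK fxi Xf HXt]; first by left.
right; exists X => //; split => // x Xx.
by exists (f x); [exact: fxi|exact: Xf].
Qed.

(** Stages indexed by kappa suffice: by regularity a small subset of their union appears below a
    single stage. *)
Lemma exists_closed : exists Q, [/\ A `<=` Q, Q #<= [set: L] &
  forall X, X `<=` Q -> X #< [set: K] -> H X `<=` Q].
Proof.
have [k0] : [set: K] !=set0.
  by apply/set0P/negP => /eqP K0; apply: K_uncountable; rewrite K0.
move=> _; exists (\bigcup_xi stage xi); split.
- by move=> t At; exists k0 => //; left.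
- by apply: card_bigcup => // xi _; exact: card_stage.
move=> X XQ XK t HXt.
have exf x : exists xi, X x -> stage xi x.
  by have [/XQ[xi _ ?]|] := pselect (X x); [exists xi|exists k0].
have [f fP] := choice exf.
have [zeta fzeta] := small_bounded f XK.
by exists zeta => //; exact: (stage_step XK fzeta fP HXt).
Qed.

End Stages.

Context d (T : porderType d).

(** A maximal antichain of the closure is small by the chain condition; were it not predense in [P],
    a condition incompatible with all its members would have been added. [G] leaves room for closure
    under a club. *)
Lemma exists_regular (P A : set T) (G : set T -> set T) :
  chain_condition K P -> A `<=` P -> A #<= [set: L] ->
  (forall X, G X `<=` P) -> (forall X, X #< [set: K] -> G X #<= [set: L]) ->
  exists Q, [/\ A `<=` Q, regular_suborder P Q, Q #<= [set: L] &
    forall X, X `<=` Q -> X #< [set: K] -> G X `<=` Q].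
Proof.
move=> ccP AP AL GP GL.
(* A witness comes as a singleton, or as the empty set if there is none, to match the set-valued
   [H]. *)
have witness (R : set T -> T -> Prop) : exists w : set T -> set T,
    forall X, [/\ w X #<= [set: L], w X `<=` P &
      forall p, P p -> R X p -> exists2 q, w X q & R X q].
  have ex X : exists wX : set T, [/\ wX #<= [set: L], wX `<=` P &
      forall p, P p -> R X p -> exists2 q, wX q & R X q].
    have [[p [Pp Rp]]|nop] := pselect (exists p, P p /\ R X p).
      exists [set p]; split=> [|q ->//|_ _ _]; last by exists p.
      apply: card_le_trans KL.
      by have [] := countable_small K_uncountable (finite_set_countable (finite_set1 p)).
    exists set0; split=> // p Pp Rp.
    by case: nop; exists p.
  by have [w wP] := choice ex; exists w.
have [v vP] := witness (fun X r => forall p, X p -> r <= p).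
have [w wP] := witness (fun X r => forall p, X p -> ~ compatible P r p).
(* [v] gives common lower bounds and [w] elements incompatible with all of [X]. All values lie in
   [P], so the part of [Q] in [P] stays closed. *)
have [|Q [AQ QL Qcl]] := @exists_closed _ A (fun X => G X `|` (v X `|` w X)) AL.
  move=> X XK; apply: card_setU; first exact: GL.
  by apply: card_setU; [have [] := vP X|have [] := wP X].
have sub X : X `<=` Q `&` P -> X #< [set: K] ->
    [/\ G X `<=` Q `&` P, v X `<=` Q `&` P & w X `<=` Q `&` P].
  move=> XQ XK; have XQ' : X `<=` Q by move=> p /XQ[].
  have cl := Qcl X XQ' XK; split=> p Xp.
  - by split; [apply: cl; left|exact: (GP X)].
  - by split; [apply: cl; right; left|have [_ + _] := vP X; exact].
  - by split; [apply: cl; right; right|have [_ + _] := wP X; exact].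
have comp p q : (Q `&` P) p -> (Q `&` P) q -> compatible P p q ->
    compatible (Q `&` P) p q.
  move=> Qp Qq [r Pr [rp rq]].
  have [||_ vX _] := sub [set p; q]; first by move=> _ [->|->].
    by apply: countable_small => //; apply: finite_set_countable; exact: finite_set2.
  have [_ _ /(_ r Pr)] := vP [set p; q].
  case=> [_ [->|->]//|r' /vX Qr' r'pq].
  by exists r' => //; split; apply: r'pq; [left|right].
exists (Q `&` P); split.
- by move=> p Ap; split; [exact: AQ|exact: AP].
- apply: regular_suborderI => [p []//|//|A' maxA' p Pp].
  have antiA' : antichain P A' by apply: antichain_lift maxA'.1 => // q [].
  apply: contrapT => nocomp.
  have [_ _ wX] := sub A' maxA'.1.1 (ccP A' antiA').
  have [_ _ /(_ p Pp)] := wP A'.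
  case=> [q A'q pq|q /wX Qq qA']; first by apply: nocomp; exists q.
  have [q' A'q' qq'] := (maximal_antichainE maxA'.1).1 maxA' q Qq.
  by apply: (qA' q' A'q'); apply: compatible_sub qq' => // ? [].
- by apply: card_le_trans QL; apply: subset_card_le => p [].
- by move=> X XQ XK; have [] := sub X XQ XK.
Qed.

Lemma chain_condition_completely_layered (P : set T) :
  chain_condition K P -> completely_layered U P.
Proof.
move=> ccP; split=> [A AP AL|Q regQ QL]; last first.
  apply: chain_condition_layered => //; exact: chain_condition_regular regQ.
have [Q [AQ regQ QL _]] := @exists_regular P A (fun=> set0) ccP AP AL
  (fun _ => @sub0set _ P) (fun _ _ => card_ge0 _ _).
by exists Q.
Qed.

End Closure.

(** * Clubs and stationarity of the regular suborders *)

Section Clubs.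
Context dK dL (K : orderType dK) (L : orderType dL).
Hypotheses (K_card : is_cardinal K) (K_uncountable : ~ countable [set: K]).
Hypotheses (L_card : is_cardinal L) (KL : [set: K] #<= [set: L]).
Hypothesis L_pow : weakpow_eq L.
Variable U : set_system (Pkappa K [set: L]).
Hypothesis U_normal : normal_fine_ultrafilter U.
Context d (T : porderType d) (P : set T) (C : set (set T)).
Hypotheses (CP : C `<=` Pkappa K P) (C_cofinal : cofinal_Pkappa K P C).

Let U_ultra : UltraFilter U. Proof. by case: U_normal. Qed.
Local Existing Instance U_ultra.

Let finite_small V (X : set V) : finite_set X -> X #< [set: K].
Proof. by move=> /finite_set_countable; exact: countable_small. Qed.

(** By recursion on the size of [e], cofinality gives a member of [C] covering [e] and the values at
    its proper subsets, which are finitely many small sets. *)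
Lemma exists_club_system : exists c : {fset T} -> set T,
  [/\ forall e, [set` e] `<=` P -> C (c e),
      forall e, [set` e] `<=` P -> [set` e] `<=` c e &
      forall e e', [set` e] `<=` P -> (e' `<=` e)%fset -> c e' `<=` c e].
Proof.
have exg x : exists y, Pkappa K P x -> C y /\ x `<=` y.
  by have [/C_cofinal[y Cy xy]|] := pselect (Pkappa K P x); [exists y|exists x].
have [g gP] := choice exg.
(* The number [n] is fuel: the value at [e] no longer changes once [n] reaches the size of [e]. *)
pose c := fix c n e := if n is m.+1 then
    if (#|` e| <= m)%N then c m e
    else g ([set` e] `|` \bigcup_(e' in [set e' | (e' `<` e)%fset]) c m e')
  else g [set` e].
have cS n e : c n.+1 e = if (#|` e| <= n)%N then c n e
    else g ([set` e] `|` \bigcup_(e' in [set e' | (e' `<` e)%fset]) c n e') by [].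
have stable n e : (#|` e| <= n)%N -> c n e = c #|` e| e.
  elim: n => [|n IH]; first by rewrite leqn0 => /eqP ->.
  rewrite leq_eqVlt => /orP[/eqP -> //|]; rewrite ltnS => en.
  by rewrite cS en IH.
have properP (e e' : {fset T}) : [set` e] `<=` P -> (e' `<` e)%fset -> [set` e'] `<=` P.
  by move=> eP /fproper_sub/fsubsetP e'e x /e'e; exact: eP.
have small n e : [set` e] `<=` P -> (forall e', [set` e'] `<=` P -> C (c n e')) ->
    Pkappa K P ([set` e] `|` \bigcup_(e' in [set e' | (e' `<` e)%fset]) c n e').
  move=> eP cC; split=> [x [/eP//|[e' /(properP e e' eP)/cC/CP[+ _]]]|]; first exact.
  apply: (small_setU K_card K_uncountable KL U_normal); first exact: finite_small.
  apply: (small_bigcup K_card K_uncountable KL U_normal) => [|e'].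
    apply: finite_small; apply: (sub_finite_set _ (finite_fset (fpowerset e))) => e'.
    by rewrite /= fpowersetE => /fproper_sub.
  by move=> /(properP e e' eP)/cC/CP[].
have cC n e : [set` e] `<=` P -> C (c n e) /\ [set` e] `<=` c n e.
  elim: n e => [|n IH] e eP; first by apply: gP; split=> //; exact: finite_small.
  rewrite cS; case: ifP => _; first exact: IH.
  have [CX XX] := gP _ (small n e eP (fun e' e'P => (IH e' e'P).1)).
  by split => // x ex; apply: XX; left.
exists (fun e => c #|` e| e); split=> [e eP|e eP|e e' eP e'e].
- exact: (cC _ e eP).1.
- exact: (cC _ e eP).2.
have [->//|e'Ne] := eqVneq e' e.
have e'p : (e' `<` e)%fset by rewrite fproperEneq e'Ne.
have e'lt := fproper_ltn_card e'p.
(* With fuel one less than the size of [e], the values at proper subsets are already stable, while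
   [e] itself is handled by [g]. *)
have en : #|` e| = (#|` e|.-1).+1 by rewrite (ltn_predK e'lt).
rewrite en cS {1}en ltnn -(@stable (#|` e|).-1 e'); last by rewrite -ltnS -en.
have [_ sub] := gP _ (small _ e eP (fun e' e'P => (cC (#|` e|).-1 e' e'P).1)).
by move=> x e'x; apply: sub; right; exists e'.
Qed.

Hypothesis C_chain : chain_closed K C.

(** Closure under chains yields these directed unions by induction on an initial segment of kappa
    enumerating [a]: images of shorter segments increase to [a]. *)
Lemma club_directed_union (c : {fset T} -> set T) :
  (forall e, [set` e] `<=` P -> C (c e)) ->
  (forall e e', [set` e] `<=` P -> (e' `<=` e)%fset -> c e' `<=` c e) ->
  forall a, Pkappa K P a -> C (\bigcup_(e in [set e | [set` e] `<=` a]) c e).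
Proof.
move=> cC cmono; pose F a := \bigcup_(e in [set e | [set` e] `<=` a]) c e.
(* Adjoining a finite set to [a] makes the successor case go through. *)
have FC eta : forall a (e : {fset T}), a `<=` P -> [set` e] `<=` P ->
    a #<= [set xi : K | xi < eta] ->
    C (F (a `|` [set` e])).
  elim/(wo_ind K_card.1): eta => eta IH a e aP eP aeta.
  have [a0|] := pselect (a !=set0); last first.
    move=> /nonemptyPn ->; rewrite set0U (_ : F _ = c e); first exact: cC.
    apply/seteqP; split=> [x [e' e'e ce'x]|x cex]; last by exists e.
    by apply: (cmono e e') => //; apply/fsubsetP => y /e'e.
  have [h hE] := card_surj a0 aeta.
  pose b xi := h @` [set zeta | zeta < xi].
  have ba xi : xi <= eta -> b xi `<=` a.
    by move=> xieta _ [zeta zxi <-]; rewrite hE; exists zeta => //; exact: lt_le_trans xieta.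
  have bC xi (e' : {fset T}) : xi < eta -> [set` e'] `<=` P -> C (F (b xi `|` [set` e'])).
    move=> xieta e'P; apply: (IH xi) => //; last exact: card_image_le.
    exact: subset_trans (ba _ (ltW xieta)) aP.
  (* If the segment has a last index [xi], the point [h xi] moves into the finite part and the
     induction hypothesis applies at [xi]. *)
  have [[xi [xieta ximax]]|nomax] :=
      pselect (exists xi, xi < eta /\ forall zeta, zeta < eta -> zeta <= xi).
    have ahxi : a (h xi) by rewrite hE; exists xi.
    have -> : a `|` [set` e] = b xi `|` [set` (h xi |` e)%fset].
      apply/seteqP; split=> [x [|ex]|x [/ba|]].
      - rewrite {1}hE => -[zeta /ximax]; rewrite le_eqVlt => /orP[/eqP ->|zxi] <-.
          by right; rewrite /= !inE eqxx.
        by left; exists zeta.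
      - by right; rewrite /= !inE ex orbT.
      - by move=> /(_ (ltW xieta)); left.
      - by rewrite /= !inE => /orP[/eqP ->|ex]; [left|right].
    apply: bC => // x; rewrite /= !inE => /orP[/eqP ->|/eP //]; exact: aP.
  have above zeta : zeta < eta -> exists2 xi, xi < eta & zeta < xi.
    move=> zeta_eta; apply: contrapT => noxi; apply: nomax.
    exists zeta; split => // xi xieta.
    by rewrite leNgt; apply/negP => zxi; apply: noxi; exists xi.
  have [x0 ax0] := a0.
  have [z0 z0eta _] : exists2 z0, z0 < eta & h z0 = x0 by move: ax0; rewrite hE.
  have bmono xi zeta : xi <= zeta -> b xi `<=` b zeta.
    by move=> xz _ [y yxi <-]; exists y => //; exact: lt_le_trans xz.
  (* Without a last index, finitely many points are already captured at one [xi], so [F] commutes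
     with the increasing union. *)
  have cover (s : seq T) : (forall x, x \in s -> (a `|` [set` e]) x) ->
      exists2 xi, xi < eta & forall x, x \in s -> (b xi `|` [set` e]) x.
    elim: s => [|x s IHs] xs; first by exists z0.
    have [|xi xieta sxi] := IHs.
      by move=> y ys; apply: xs; rewrite inE ys orbT.
    have [|ax|ex] := xs x; first by rewrite inE eqxx.
      move: ax; rewrite hE => -[zeta zeta_eta hx].
      have [xi' xi'eta zxi'] := above zeta zeta_eta.
      exists (Order.max xi xi'); first by rewrite gt_max xieta.
      move=> y; rewrite inE => /orP[/eqP ->|/sxi [yb|ey]]; last by right.
        by left; exists zeta => //=; rewrite lt_max zxi' orbT.
      by left; apply: bmono yb; rewrite le_max lexx.
    exists xi => // y; rewrite inE => /orP[/eqP ->|/sxi //]; by right.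
  have -> : F (a `|` [set` e]) =
      \bigcup_(xi in [set xi | xi < eta]) F (b xi `|` [set` e]).
    apply/seteqP; split=> [x [e' e'a ce'x]|x [xi xieta [e' e'b ce'x]]].
      by have [xi xieta e'xi] := cover e' e'a; exists xi => //; exists e'.
    by exists e' => // y /e'b[/(ba _ (ltW xieta))|]; [left|right].
  apply: C_chain; [by exists z0|by move=> xi xieta; exact: bC|].
  move=> xi zeta xz _ x [e' e'b ce'x]; exists e' => // y /e'b[by_|ey]; last by right.
  by left; apply: bmono by_.
move=> a [aP aK]; have [eta aeta] := card_lt_segment K_card.1 aK.
have := FC eta a fset0 aP _ aeta; rewrite (_ : [set` fset0] = set0) ?setU0; first exact.
by rewrite -subset0 => x; rewrite /= inE.
Qed.

Lemma club_meets_layers :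
  chain_condition K P -> Reg K P `&` C !=set0.
Proof.
move=> ccP; have [c [cC cin cmono]] := exists_club_system.
(* [G] extends [c] to arbitrary sets, with empty value off the finite subsets of [P]. *)
pose G X := [set t | X `<=` P /\ finite_set X /\ c (fset_set X) t].
have GK X : Pkappa K P (G X).
  have [[XP Xfin]|nX] := pselect (X `<=` P /\ finite_set X); last first.
    rewrite (_ : G X = set0); first by split=> //; exact: finite_small (finite_set0 _).
    by rewrite -subset0 => t [XP [Xfin _]]; apply: nX.
  have /cC/CP[cP cK] : [set` fset_set X] `<=` P by rewrite fset_setK.
  split=> [t [_ [_ /cP//]]|].
  by apply: card_le_lt_trans cK; apply: subset_card_le => t [_ []].
have GP X : G X `<=` P by exact: (GK X).1.
have GL X : X #< [set: K] -> G X #<= [set: L].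
  by move=> _; apply: card_le_trans KL; exact: (GK X).2.1.
have [Q [_ regQ QL QG]] := exists_regular K_card K_uncountable L_card KL L_pow U_normal
  ccP (@sub0set _ P) (card_ge0 _ _) GP GL.
have [QP _ _] := regQ.
have cQ (e : {fset T}) : [set` e] `<=` Q -> c e `<=` Q.
  move=> eQ x ex; apply: (QG [set` e] eQ); first exact/finite_small/finite_fset.
  split; first exact: subset_trans QP.
  by split; [exact: finite_fset|rewrite set_fsetK].
(* An empty [Q] is not the range of any [s], but then it equals [c fset0] and is itself in [C]. *)
have [Q0|] := pselect (Q !=set0); last first.
  move=> /nonemptyPn Q0; exists Q; split.
    by split=> //; rewrite Q0; apply: finite_small; exact: finite_set0.
  have fsetQ : [set` (fset0 : {fset T})] `<=` Q by move=> x; rewrite /= inE.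
  have cE : c fset0 = Q.
    by apply/seteqP; split; [exact: cQ|rewrite Q0].
  by rewrite -cE; apply: cC; exact: subset_trans QP.
have [s sE] := card_surj Q0 QL.
have ccQ := chain_condition_regular ccP regQ.
have [_ /(_ s (esym sE)) Ureg] :=
  chain_condition_layered U_normal ccQ QL.
(* The diagonal intersection runs over sequences of indices because the finite subsets of a layer
   are the [s]-images of finite sequences from [a]. *)
have Uclosed := measure_diagonal_seq K_uncountable U_normal
  (R := fun l => [set a | c [fset x in map s l]%fset `<=` s @` val a]).
have [|a [areg aclosed]] := filter_ex (filterI Ureg (Uclosed _)).
  move=> l; have lQ : [set` [fset x in map s l]%fset] `<=` Q.
    by move=> x; rewrite /= inE => /mapP[y _ ->]; rewrite sE; exists y.
  apply: (measure_fine_small U_normal); last by rewrite -sE; exact: cQ.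
  by have [] := CP (cC _ (subset_trans lQ QP)).
exists (s @` val a); split.
  by split; [exact: regular_suborder_trans areg.1|exact: areg.2].
have aQ : s @` val a `<=` Q by rewrite sE => _ [x _ <-]; exists x.
have lift (t : seq T) : (forall x, x \in t -> (s @` val a) x) ->
    exists2 l, (forall x, x \in l -> val a x) & map s l = t.
  elim: t => [|x t IH] xt; first by exists [::].
  have [|l la lt] := IH; first by move=> y yt; apply: xt; rewrite inE yt orbT.
  have [|z az zx] := xt x; first by rewrite inE eqxx.
  exists (z :: l); last by rewrite /= zx lt.
  by move=> y; rewrite inE => /orP[/eqP ->|/la].
have -> : s @` val a = \bigcup_(e in [set e : {fset T} | [set` e] `<=` s @` val a]) c e.
  apply/seteqP; split=> x.
    move=> ax; exists [fset x]%fset => [y|]; first by rewrite /= inE => /eqP ->.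
    apply: cin; last by rewrite /= inE.
    by move=> y; rewrite /= inE => /eqP ->; apply/QP/aQ.
  case=> e ea; have [l la le] := lift e ea.
  have -> : e = [fset x in map s l]%fset by apply/fsetP => y; rewrite inE le.
  by move: x; exact: aclosed la.
apply: club_directed_union => //; split; first exact: subset_trans QP.
exact: areg.2.
Qed.

End Clubs.

Lemma chain_condition_stationarily_layered dK dL (K : orderType dK) (L : orderType dL)
    (U : set_system (Pkappa K [set: L])) d (T : porderType d) (P : set T) :
  is_cardinal K -> ~ countable [set: K] -> is_cardinal L -> [set: K] #<= [set: L] ->
  weakpow_eq L -> normal_fine_ultrafilter U ->
  chain_condition K P -> stationarily_layered K P.
Proof.
move=> K_card K_unc L_card KL L_pow U_normal ccP C CP C_cofinal C_chain.
exact: (club_meets_layers K_card K_unc L_card KL L_pow U_normal).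
Qed.

Theorem theorem4p4 (dK dL : Order.disp_t)
    (kappa : orderType dK) (lambda : orderType dL)
    (kappa_card : is_cardinal kappa) (lambda_card : is_cardinal lambda)
    (kappa_supercompact : supercompact kappa lambda)
    (U : set_system (Pkappa kappa [set: lambda]))
    (U_normal : normal_fine_ultrafilter U)
    (lambda_pow : weakpow_eq lambda)
    (d : Order.disp_t) (P : porderType d) :
  [<-> chain_condition kappa [set: P];
       knaster kappa [set: P];
       stationarily_layered kappa [set: P];
       completely_layered U [set: P]].
Proof.
have [kappa_unc kappa_lambda _] := kappa_supercompact.
have layered_knaster : completely_layered U [set: P] -> knaster kappa [set: P].
  exact: completely_layered_knaster.
have knaster_cc : knaster kappa [set: P] -> chain_condition kappa [set: P].
  exact: knaster_chain_condition.
have cc_layered : chain_condition kappa [set: P] -> completely_layered U [set: P].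
  exact: chain_condition_completely_layered.
(* The chain condition gives complete layering, hence Knaster, hence the chain condition again;
   stationary layering is tied to the chain condition in both directions. *)
tfae.
- by move=> /cc_layered/layered_knaster.
- by move=> /knaster_cc; exact: chain_condition_stationarily_layered U_normal.
- move=> stP; apply: cc_layered.
  exact: (stationarily_layered_chain_condition kappa_card kappa_unc kappa_lambda U_normal).
- by move=> /layered_knaster/knaster_cc.
Qed.
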